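(* Let $A$ be a bounded reductive normal operator on $\mathcal{H}$ and let $\mathcal{G}\subset\mathcal{H}$ be a set of vectors. If $|\mathcal{G}|<\infty$, then for any $L\in\mathcal{L}$ the system $\{A^n g\}_{g\in\mathcal{G},\,0\le n<L(g)}$ is never a basis for $\mathcal{H}$.
   Context: $\mathcal{H}$ is an infinite-dimensional separable complex Hilbert space. An operator $A$ is reductive if for every closed invariant subspace $V$ of $A$, $V^\perp$ is also invariant under $A$. Let $\mathbb{N}^*=\{1,2,\dots\}\cup\{+\infty\}$. For the given $A$ and $\mathcal{G}$, $\mathcal{L}$ is the class of functions $L:\mathcal{G}\to\mathbb{N}^*$ such that the closed linear span of $\{A^n g\}_{g\in\mathcal{G},\,0\le n<L(g)}$ equals the closed linear span of $\{A^n g\}_{g\in\mathcal{G},\,n\ge0}$. Systems are regarded as families indexed by pairs $(g,n)$. ''Basis'' means Schauder basis with respect to some enumeration of the index set (in particular every Riesz basis is a basis). *)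

(* Defs.v *)
From HB Require Import structures.
From mathcomp Require Import all_boot all_order all_algebra.
From mathcomp Require Import all_classical all_reals all_analysis.
From mathcomp Require Import complex.

Set Implicit Arguments.
Unset Strict Implicit.
Unset Printing Implicit Defensive.

Import Order.TTheory GRing.Theory Num.Theory.
Import numFieldNormedType.Exports.

Local Open Scope classical_set_scope.
Local Open Scope ring_scope.

(* A Hilbert space is a complete normed space over R[i] together with a positive
   definite Hermitian form (linear on the left, conjugate-linear on the right)
   that induces the norm. *)
Definition induces_norm (R : realType) (H : completeNormedModType R[i])
    (dot : {dot H for Num.conj}) :=
  forall x : H, `|x| ^+ 2 = dot x x.

Definition separable (T : topologicalType) :=
  exists2 D : set T, countable D & dense D.

Section Spans.
Context {R : realType} {H : completeNormedModType R[i]}.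

Definition lin_span (S : set H) : set H :=
  [set x | exists n (v : 'I_n -> H) (c : 'I_n -> R[i]),
     (forall i, S (v i)) /\ x = \sum_i c i *: v i].

Definition closed_span (S : set H) : set H := closure (lin_span S).

End Spans.

Definition infinite_dimensional (R : realType) (H : completeNormedModType R[i]) :=
  forall S : set H, finite_set S -> lin_span S <> setT.

Section Operators.
Context {R : realType} {H : completeNormedModType R[i]}.
Variable dot : {dot H for Num.conj}.

Definition bounded_op (A : {linear H -> H}) := bounded_near A (nbhs (0 : H)).

Definition adjoint (A B : H -> H) := forall x y, dot (A x) y = dot x (B y).

(* The adjoint of a bounded operator exists and is unique, so this is A A* = A* A. *)
Definition normal_op (A : H -> H) := exists2 B, adjoint A B & A \o B =1 B \o A.

Definition closed_subspace (V : set H) := closed V /\ submod_closed (mem V).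

Definition invariant (A : H -> H) (V : set H) := A @` V `<=` V.

Definition orthogonal_complement (V : set H) : set H :=
  [set y | forall x, V x -> dot x y = 0].

Definition reductive (A : H -> H) :=
  forall V, closed_subspace V -> invariant A V ->
    invariant A (orthogonal_complement V).

End Operators.

(* {1, 2, ...} together with +oo, the latter being None *)
Definition Nstar := option {n : nat | (0 < n)%N}.

Definition lt_Nstar (n : nat) (l : Nstar) : bool :=
  if l is Some m then (n < val m)%N else true.

Section Iterations.
Context {R : realType} {H : completeNormedModType R[i]}.

Definition iterates (A : H -> H) (gn : H * nat) : H := iter gn.2 A gn.1.

Definition iter_index (G : set H) (L : G -> Nstar) : set (H * nat) :=
  [set gn | exists g : G, gn.1 = val g /\ lt_Nstar gn.2 (L g)].

Definition class_L (A : H -> H) (G : set H) : set (G -> Nstar) :=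
  [set L | closed_span (iterates A @` iter_index L) =
           closed_span (iterates A @` [set gn | G gn.1])].

End Iterations.

Section SchauderBases.
Context {R : realType} {H : completeNormedModType R[i]} {I : Type}.

(* D is either {0, ..., N - 1} or the whole of nat: enumerations may be finite. *)
Definition enumerates (J : set I) (D : set nat) (e : nat -> I) :=
  (forall m n, (m <= n)%N -> D n -> D m) /\ set_bij D J e.

Definition expansion (f : I -> H) (D : set nat) (e : nat -> I)
    (c : nat -> R[i]) (x : H) :=
  (\sum_(0 <= k < n | k \in D) c k *: f (e k)) @[n --> \oo] --> x.

Definition schauder_basis (f : I -> H) (J : set I) :=
  exists (D : set nat) (e : nat -> I), enumerates J D e /\
    forall x, exists2 c, expansion f D e c x &
      forall c', expansion f D e c' x -> {in D, c' =1 c}.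

End SchauderBases.

(* Main.v *)
Require Import Defs.
From HB Require Import structures.
From mathcomp Require Import all_boot all_order all_algebra.
From mathcomp Require Import all_classical all_reals all_analysis.
From mathcomp Require Import complex ring lra.

Set Implicit Arguments.
Unset Strict Implicit.
Unset Printing Implicit Defensive.

Import Order.TTheory GRing.Theory Num.Theory.
Import numFieldNormedType.Exports.

Local Open Scope classical_set_scope.
Local Open Scope ring_scope.

(** Two facts are in conflict.

    On the operator side, every vector [g] satisfies
    [A g \in closed_span {A^n g | n >= 2}] ([image_in_tail_span]). Call this
    closed span [W]. It is invariant under [A], and since [A] is reductive so
    is its orthogonal complement. Let [p] be the projection of [A g] on [W]
    and [u = A g - p]. Then [A u] lies in [W], because [A (A g)] and [A p] do,
    and in the orthogonal complement of [W], because [u] does; hence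
    [A u = 0]. As [A] is normal, its kernel is orthogonal to its range, so [u]
    is orthogonal to [A g]; it is also orthogonal to [p], hence to itself, and
    [A g = p].

    On the basis side, a Schauder basis of a Banach space is minimal: no
    member lies in the closed span of the others
    ([schauder_basis_minimal]). This is the continuity of the coordinate
    functionals, which follows from a uniform bound on the partial sum
    operators ([psum_bounded]), obtained as in the open mapping theorem: by
    Baire, every [x] is approximated by vectors whose partial sums are bounded
    by a multiple of the norm of [x] ([psum_approx]), and successive
    approximation produces an expansion with such bounds that must be the one
    of [x].

    A basis of an infinite-dimensional space is infinite, so when [G] is finite
    some [g] has [L g] infinite. The system then contains all [A^n g], and
    [A g] contradicts minimality. *)

(** * The norm as a real number *)

Section RealNorm.
Local Open Scope complex_scope.
Context {R : realType} {H : completeNormedModType R[i]}.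
Implicit Types (x y z : H) (u : nat -> H).

(** The norm of [H] takes values in [R[i]], where the order is partial; [nrm]
    is the same norm with values in [R]. *)
Definition nrm x : R := complex.Re `|x|.

Lemma nrmE x : `|x| = (nrm x)%:C.
Proof. by rewrite /nrm RRe_real. Qed.

Lemma nrm_ge0 x : 0 <= nrm x.
Proof. by rewrite -ler0c -nrmE. Qed.

Lemma nrm0 : nrm (0 : H) = 0.
Proof. by apply: complexI; rewrite -nrmE normr0. Qed.

Lemma nrm0_eq0 x : nrm x = 0 -> x = 0.
Proof. by move=> x0; apply/eqP; rewrite -normr_eq0 nrmE x0. Qed.

Lemma nrm_gt0 x : (0 < nrm x) = (x != 0).
Proof. by rewrite -normr_gt0 nrmE ltcR. Qed.

Lemma nrmD x y : nrm (x + y) <= nrm x + nrm y.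
Proof. by rewrite -lecR rmorphD /= -!nrmE ler_normD. Qed.

Lemma nrmN x : nrm (- x) = nrm x.
Proof. by rewrite /nrm normrN. Qed.

Lemma nrmBC x y : nrm (x - y) = nrm (y - x).
Proof. by rewrite -opprB nrmN. Qed.

Lemma nrmB x y : nrm (x - y) <= nrm x + nrm y.
Proof. by rewrite -(nrmN y) nrmD. Qed.

Lemma nrm_triangle y x z : nrm (x - z) <= nrm (x - y) + nrm (y - z).
Proof. by rewrite -[x - z](subrKA y) nrmD. Qed.

Lemma nrmZ (c : R[i]) x : nrm (c *: x) = complex.Re `|c| * nrm x.
Proof.
apply: complexI.
by rewrite rmorphM /= -!nrmE normrZ.
Qed.

Lemma nrmZR (t : R) x : 0 <= t -> nrm (t%:C *: x) = t * nrm x.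
Proof. by move=> t0; rewrite nrmZ ger0_norm // ler0c. Qed.

Lemma nrm_ballE x (e : R) : ball x e%:C = [set y | nrm (x - y) < e].
Proof. by rewrite -ball_normE; apply/funext => y /=; rewrite nrmE ltcR. Qed.

Lemma nrm_nbhsP x (A : set H) :
  nbhs x A <-> exists2 e : R, 0 < e & [set y | nrm (x - y) < e] `<=` A.
Proof.
split=> [/nbhs_ballP[e /= e0 eA]|[e e0 eA]].
  have re : e \is Num.real by rewrite realE ltW.
  exists (complex.Re e); first by rewrite -ltcR RRe_real.
  by rewrite -nrm_ballE RRe_real.
by apply/nbhs_ballP; exists e%:C; rewrite /= ?ltcR // nrm_ballE.
Qed.

Lemma nrm_closureP (A : set H) x :
  closure A x <-> forall e : R, 0 < e -> exists2 y, A y & nrm (x - y) < e.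
Proof.
split=> [clA e e0|clA B /nrm_nbhsP[e e0 eB]].
  have [|y [Ay xy]] := clA [set y | nrm (x - y) < e]; last by exists y.
  by apply/nrm_nbhsP; exists e.
by have [y Ay xy] := clA e e0; exists y; split=> //; exact: eB.
Qed.

Lemma nrm_cvgP u x : u @ \oo --> x <->
  forall e : R, 0 < e ->
    exists M, forall n, (M <= n)%N -> nrm (x - u n) < e.
Proof.
split=> [ux e e0|ux B /nrm_nbhsP[e e0 eB]].
  have [|M _ Mu] := ux [set y | nrm (x - y) < e].
    by apply/nrm_nbhsP; exists e.
  by exists M => n /Mu.
by have [M Mu] := ux e e0; exists M => // n /= /Mu; exact: eB.
Qed.

Lemma nrm_complete u :
  (forall e : R, 0 < e ->
    exists x, exists M, forall n, (M <= n)%N -> nrm (x - u n) < e) ->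
  exists x, u @ \oo --> x.
Proof.
move=> cu; apply/cvg_ex/cauchy_cvgP/cauchy_exP => e e0.
have re : e \is Num.real by rewrite realE ltW.
have [|x [M xM]] := cu (complex.Re e); first by rewrite -ltcR RRe_real.
exists x; rewrite -[e]RRe_real // nrm_ballE.
by exists M.
Qed.

Lemma cvg_nrm_le u x z (d : R) :
  u @ \oo --> x -> (exists M, forall n, (M <= n)%N -> nrm (z - u n) <= d) ->
  nrm (z - x) <= d.
Proof.
move=> /nrm_cvgP ux [M zu]; apply/ler_addgt0Pr => e /ux[P Pu].
have := nrm_triangle (u (maxn M P)) z x.
have := zu (maxn M P) (leq_maxl _ _).
have := Pu (maxn M P) (leq_maxr _ _).
by rewrite (nrmBC x); lra.
Qed.

Lemma small_half_pow (C e : R) : 0 < e -> exists M, C * 2^-1 ^+ M < e.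
Proof.
move=> e0.
have /cvgrPdist_lt/(_ e e0) : (fun n => C * 2^-1 ^+ n) @ \oo --> (0 : R).
  rewrite -[X in _ --> X](mulr0 C); apply: cvgMr.
  by apply: cvg_expr; rewrite ger0_norm ?invr_ge0 // invf_lt1 // ltr1n.
move=> [M _ /(_ M (leqnn M)) /=]; rewrite sub0r normrN.
by move=> /(le_lt_trans (ler_norm _)) ?; exists M.
Qed.

Lemma nrm_geometric_dist u (C : R) :
  (forall n, nrm (u n.+1 - u n) <= C * 2^-1 ^+ n) ->
  forall m n, (m <= n)%N -> nrm (u n - u m) <= 2 * C * 2^-1 ^+ m.
Proof.
move=> uC m n /subnKC <-.
(* the telescoped bound, kept sharp so that the induction goes through *)
suff : nrm (u (m + (n - m))%N - u m) <=
    2 * C * 2^-1 ^+ m - 2 * C * 2^-1 ^+ (m + (n - m)).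
  have : 0 <= C.
    by have := uC 0%N; rewrite expr0 mulr1; apply: le_trans; exact: nrm_ge0.
  have : 0 < 2^-1 ^+ (m + (n - m)) :> R by rewrite exprn_gt0.
  by nra.
elim: (n - m)%N => [|k IHk]; first by rewrite addn0 !subrr nrm0.
have := nrm_triangle (u (m + k)%N) (u (m + k.+1)%N) (u m).
by have := uC (m + k)%N; rewrite addnS exprS; lra.
Qed.

Lemma nrm_geometric_cvg u (C : R) :
  (forall n, nrm (u n.+1 - u n) <= C * 2^-1 ^+ n) ->
  exists2 x, u @ \oo --> x & forall n, nrm (x - u n) <= 2 * C * 2^-1 ^+ n.
Proof.
move=> uC; have dist := nrm_geometric_dist uC.
have [|x ux] := @nrm_complete u.
  move=> e /(small_half_pow (2 * C))[M Me]; exists (u M), M => n Mn.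
  by rewrite nrmBC; apply: le_lt_trans Me; exact: dist.
exists x => // n; rewrite nrmBC; apply: (cvg_nrm_le ux).
by exists n => k nk; rewrite nrmBC; exact: dist.
Qed.

End RealNorm.

(** * Baire's theorem *)

Section Baire.
Local Open Scope complex_scope.
Context {R : realType} {H : completeNormedModType R[i]}.

(** If countably many sets cover [H], the closure of one of them contains a
    ball. Otherwise one builds nested balls, the [m]-th of which misses [F m]:
    their centres converge to a point that no [F m] contains. *)
Lemma baire_cover (F : nat -> set H) : (forall x, exists m, F m x) ->
  exists m (x : H) (r : R),
    0 < r /\ forall y, nrm (x - y) < r -> closure (F m) y.
Proof.
move=> coverF; apply: contrapT => noball.
(* inside the ball of centre q.2.1 and radius q.2.2, a ball of at most half the
   radius that misses F q.1 *)
have step (q : nat * (H * R)) : exists p : H * R, 0 < q.2.2 ->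
    [/\ 0 < p.2, p.2 <= q.2.2 * 2^-1, nrm (p.1 - q.2.1) <= q.2.2 * 2^-1 &
      forall z, nrm (p.1 - z) <= p.2 -> ~ F q.1 z].
  case: q => m [x r] /=; have [r0|] := boolP (0 < r); last by exists (x, r).
  have [y [xy /nrm_closureP nFy]] :
      exists y, nrm (x - y) < r * 2^-1 /\ ~ closure (F m) y.
    apply: contrapT => nex; apply: noball; exists m, x, (r * 2^-1).
    split=> [|y xy]; first by lra.
    by apply: contrapT => nFy; apply: nex; exists y.
  have [e [e0 eF]] :
      exists e : R, 0 < e /\ forall z, nrm (y - z) < e -> ~ F m z.
    apply: contrapT => nex; apply: nFy => e e0; apply: contrapT => nF.
    by apply: nex; exists e; split=> // z ze Fz; apply: nF; exists z.
  exists (y, Num.min r e * 2^-1) => _ /=.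
  have m0 : 0 < Num.min r e by rewrite lt_min r0.
  have mr : Num.min r e <= r by rewrite ge_min lexx.
  have me : Num.min r e <= e by rewrite ge_min lexx orbT.
  split; [lra | lra | by rewrite nrmBC ltW |].
  by move=> z yz; apply: eF; lra.
have [f fP] := choice step.
pose fix p n : H * R := if n is k.+1 then f (k, p k) else (0, 1).
have p0 n : 0 < (p n).2.
  by elim: n => [|n IHn]; rewrite /= ?ltr01 //; case: (fP (n, p n)).
have pP n : [/\ 0 < (p n.+1).2, (p n.+1).2 <= (p n).2 * 2^-1,
    nrm ((p n.+1).1 - (p n).1) <= (p n).2 * 2^-1 &
    forall z, nrm ((p n.+1).1 - z) <= (p n.+1).2 -> ~ F n z].
  exact: fP (n, p n) (p0 n).
have radius m k : (p (m + k)%N).2 <= (p m).2 * 2^-1 ^+ k.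
  elim: k => [|k IHk]; first by rewrite addn0 expr0 mulr1.
  by have [_ + _ _] := pP (m + k)%N; rewrite addnS exprS; lra.
have centre m k : nrm ((p (m + k.+1)%N).1 - (p (m + k)%N).1) <=
    (p m).2 * 2^-1 * 2^-1 ^+ k.
  have [_ _ + _] := pP (m + k)%N; rewrite addnS => /le_trans; apply.
  by rewrite mulrAC ler_pM2r ?invr_gt0 // radius.
have [x px _] := nrm_geometric_cvg (centre 0%N).
have [m Fmx] := coverF x.
have [_ _ _ /(_ x)] := pP m; apply=> //; apply: (cvg_nrm_le px).
exists m.+1 => n /subnKC mn.
have := nrm_geometric_dist (centre m.+1) (leq0n (n - m.+1)%N).
by rewrite addn0 expr0 mn mulr1 nrmBC add0n; lra.
Qed.

End Baire.

(** * Schauder bases are minimal *)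

Section SchauderMinimality.
Local Open Scope complex_scope.
Context {R : realType} {H : completeNormedModType R[i]}.
Implicit Types (x y z : H) (u : nat -> H).

Lemma cvg_nrm_bounded u x : u @ \oo --> x ->
  exists m : nat, forall n, nrm (u n) <= m%:R.
Proof.
move=> /nrm_cvgP/(_ 1 ltr01)[M uM].
pose B := \sum_(i < M) nrm (u i) + (nrm x + 1).
have sum_ge0 (P : pred 'I_M) : 0 <= \sum_(i < M | P i) nrm (u i).
  by apply: sumr_ge0 => i _; exact: nrm_ge0.
exists (Num.trunc B).+1 => n; apply/ltW/(le_lt_trans _ (truncnS_gt B)).
have [Mn|nM] := leqP M n.
  have := nrm_triangle x (u n) 0; rewrite !subr0 nrmBC.
  by have := uM n Mn; have := sum_ge0 predT; rewrite /B; lra.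
rewrite /B (bigD1 (Ordinal nM)) //=.
by have := sum_ge0 (fun i => i != Ordinal nM); have := nrm_ge0 x; lra.
Qed.

Lemma re_norm_le (a : R[i]) :
  complex.Re `|a| <= `|complex.Re a| + `|complex.Im a|.
Proof.
case: a => a b /=.
rewrite -[leRHS]ger0_norm ?addr_ge0 // -sqrtr_sqr ler_wsqrtr //.
have := mulr_ge0 (normr_ge0 a) (normr_ge0 b).
by rewrite -(real_normK (num_real a)) -(real_normK (num_real b)); nra.
Qed.

Lemma re_le_norm (a : R[i]) : `|complex.Re a| <= complex.Re `|a|.
Proof.
by case: a => a b /=; rewrite -sqrtr_sqr ler_wsqrtr // lerDl sqr_ge0.
Qed.

Lemma im_le_norm (a : R[i]) : `|complex.Im a| <= complex.Re `|a|.
Proof.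
by case: a => a b /=; rewrite -sqrtr_sqr ler_wsqrtr // lerDr sqr_ge0.
Qed.

(** Lines are closed, by completeness of the scalars: the real and imaginary
    parts of the coefficients are Cauchy sequences. *)
Lemma line_closed (b v : H) (a : nat -> R[i]) :
  (fun j => a j *: b) @ \oo --> v -> exists l, v = l *: b.
Proof.
move=> abv; have [b0|bN0] := eqVneq b 0.
  exists 0; rewrite scale0r; apply: (cvg_unique (@norm_hausdorff _ H) abv).
  rewrite (_ : (fun j => _) = fun=> 0); first exact: cvg_cst.
  by apply/funext => j; rewrite b0 scaler0.
have nb0 : 0 < nrm b by rewrite nrm_gt0.
have part_cvg (p : R[i] -> R) : (forall c c', p (c - c') = p c - p c') ->
    (forall c, `|p c| <= complex.Re `|c|) ->
    exists l : R, (fun j => p (a j)) @ \oo --> l.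
  move=> pB ple; apply/cvg_ex/cauchy_cvgP/cauchy_exP => e e0.
  have eb0 : 0 < e * nrm b / 2 by rewrite divr_gt0 // mulr_gt0.
  have [M Mv] := (nrm_cvgP _ _).1 abv _ eb0.
  exists (p (a M)), M => // n /= /Mv nv; have Mv' := Mv M (leqnn M).
  rewrite /ball /= -pB; apply: le_lt_trans (ple _) _.
  rewrite -(ltr_pM2r nb0) -nrmZ scalerBl.
  have := nrm_triangle v (a M *: b) (a n *: b); rewrite nrmBC.
  by rewrite (nrmBC _ v); move: Mv' nv; lra.
have [lr lrP] := part_cvg (@complex.Re R) (fun _ _ => raddfB _ _ _) re_le_norm.
have [li liP] := part_cvg (@complex.Im R) (fun _ _ => raddfB _ _ _) im_le_norm.
exists (lr +i* li); apply: (cvg_unique (@norm_hausdorff _ H) abv).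
apply/nrm_cvgP => e e0.
have eb0 : 0 < e / nrm b / 2 by rewrite !divr_gt0.
have /cvgrPdist_lt/(_ _ eb0)[M _ rM] := lrP.
have /cvgrPdist_lt/(_ _ eb0)[N _ iN] := liP.
exists (maxn M N) => n; rewrite geq_max => /andP[/rM /= rn /iN /= inn].
rewrite -scalerBl nrmZ -ltr_pdivlMr //; apply: le_lt_trans (re_norm_le _) _.
case: (a n) rn inn => /= ? ? ? ?; lra.
Qed.

(** The [n]-th partial sum of the series of general term [d k *: b k]. *)
Definition psum (b : nat -> H) (d : nat -> R[i]) n :=
  \sum_(0 <= k < n) d k *: b k.

Lemma psumS b d n : psum b d n.+1 = psum b d n + d n *: b n.
Proof. by rewrite /psum big_nat_recr. Qed.

Lemma psum_lin b a d d' n :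
  psum b (fun k => a * d k + d' k) n = a *: psum b d n + psum b d' n.
Proof.
rewrite /psum scaler_sumr -big_split /=; apply: eq_bigr => k _.
by rewrite scalerDl scalerA.
Qed.

(** From here on, [b] is a Schauder basis and [coef x] is the sequence of
    coefficients of [x]. *)
Variables (b : nat -> H) (coef : H -> nat -> R[i]).
Hypothesis coefP : forall x, psum b (coef x) @ \oo --> x.
Hypothesis coef_unique : forall x d, psum b d @ \oo --> x -> d =1 coef x.
Arguments coefP : clear implicits.

Local Notation S x := (psum b (coef x)).

Lemma coef_lin a x y k : coef (a *: x + y) k = a * coef x k + coef y k.
Proof.
apply/esym; apply: (coef_unique (d := fun k => a * coef x k + coef y k)).
rewrite (_ : psum b _ = fun n => a *: S x n + S y n); last first.
  by apply/funext => n; exact: psum_lin.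
by apply: cvgD; [exact: cvgZl_tmp|].
Qed.

Lemma psum_coef_lin a x y n : S (a *: x + y) n = a *: S x n + S y n.
Proof. by rewrite -psum_lin; apply: eq_bigr => k _; rewrite coef_lin. Qed.

Lemma psum_coef0 n : S 0 n = 0.
Proof.
by have := psum_coef_lin (-1) 0 0 n; rewrite scaler0 addr0 scaleN1r addNr.
Qed.

Lemma psum_coefD x y n : S (x + y) n = S x n + S y n.
Proof. by have := psum_coef_lin 1 x y n; rewrite !scale1r. Qed.

Lemma psum_coefZ a x n : S (a *: x) n = a *: S x n.
Proof. by have := psum_coef_lin a x 0 n; rewrite !addr0 psum_coef0 addr0. Qed.

Lemma psum_coefB x y n : S (x - y) n = S x n - S y n.
Proof. by rewrite psum_coefD -scaleN1r psum_coefZ scaleN1r. Qed.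

Lemma basis_neq0 k : b k != 0.
Proof.
apply/eqP => bk0; pose d j : R[i] := (j == k)%:R.
have psum0 c : (forall j, c j *: b j = 0) -> psum b c @ \oo --> (0 : H).
  move=> c0; rewrite (_ : psum b c = fun=> 0); first exact: cvg_cst.
  by apply/funext => n; apply: big1 => j _.
have d0 : d =1 coef 0.
  apply: coef_unique; apply: psum0 => j; rewrite /d.
  by case: eqP => [->|_]; rewrite ?bk0 ?scaler0 ?scale0r.
have z0 : (fun=> 0) =1 coef 0.
  by apply: coef_unique; apply: psum0 => j; rewrite scale0r.
by have := d0 k; rewrite -z0 /d eqxx => /eqP; rewrite oner_eq0.
Qed.

(** By Baire, some ball of centre [x0] lies in the closure of the set [F m] of
    vectors whose partial sums are bounded by [m]. Rescale [x] to a vector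
    [t *: x] smaller than the radius of this ball: it is a difference of two
    points of the ball, [x0 + t *: x] and [x0], hence close to a difference of
    two elements of [F m]. *)
Lemma psum_approx : exists2 K : R, 0 <= K & forall x (e : R), 0 < e ->
  exists2 z, nrm (x - z) < e & forall n, nrm (S z n) <= K * nrm x.
Proof.
pose F m := [set x | forall n, nrm (S x n) <= m%:R].
have [|m [x0 [r [r0 rF]]]] := @baire_cover R H F.
  by move=> x; have [m xm] := cvg_nrm_bounded (coefP x); exists m.
exists (4 * m%:R / r) => [|x e e0]; first by rewrite divr_ge0 ?mulr_ge0 // ltW.
have [->|xN0] := eqVneq x 0.
  by exists 0 => [|n]; rewrite ?subr0 ?psum_coef0 ?nrm0 ?mulr0.
have nx0 : 0 < nrm x by rewrite nrm_gt0.
pose t := r / (2 * nrm x).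
have t0 : 0 < t by rewrite divr_gt0 // mulr_gt0.
have tx : t * nrm x = r / 2 by rewrite /t; field; rewrite gt_eqF.
have et0 : 0 < e * t / 2 by rewrite divr_gt0 // mulr_gt0.
have [||z1 Fz1 z1e] :=
    (nrm_closureP _ _).1 (rF (x0 + t%:C *: x) _) (e * t / 2) => //.
  by rewrite opprD addNKr nrmN nrmZR ?ltW // tx; lra.
have [||z0 Fz0 z0e] := (nrm_closureP _ _).1 (rF x0 _) (e * t / 2) => //.
  by rewrite subrr nrm0.
have tV : t%:C * (t^-1)%:C = 1 by rewrite -rmorphM /= divff ?gt_eqF.
exists ((t^-1)%:C *: (z1 - z0)) => [|n].
  rewrite -(ltr_pM2l t0) -nrmZR ?ltW // scalerBr scalerA tV scale1r.
  have := nrmB (x0 + t%:C *: x - z1) (x0 - z0).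
  rewrite (_ : x0 + _ - z1 - (x0 - z0) = t%:C *: x - (z1 - z0)); first by lra.
  rewrite !opprB [x0 + _]addrC -!addrA; congr (_ + _).
  by rewrite addrC -!addrA addNr addr0 addrC.
have tV0 : 0 <= t^-1 by rewrite invr_ge0 ltW.
rewrite psum_coefZ psum_coefB nrmZR // ler_pdivrMl //.
rewrite (_ : t * (4 * m%:R / r * nrm x) = 2 * m%:R).
  by have := nrmB (S z1 n) (S z0 n); have := Fz1 n; have := Fz0 n; lra.
by rewrite mulrCA tx; field; rewrite gt_eqF.
Qed.

(** Successive approximation: [y j] is what remains of [x] after [j] steps, of
    norm at most [nrm x / 2 ^ j], and [w j = x - y j] is the sum of the first
    [j] approximations. The partial sums of [w j] converge in [j], uniformly
    in [n], to some [T n]; the sequence [T] is again made of partial sums, and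
    it converges to [x], so that it consists of the partial sums of [x]. *)
Lemma psum_bounded : exists K : R, forall x n, nrm (S x n) <= K * nrm x.
Proof.
have [K K0 approx] := psum_approx.
exists (2 * K) => x n0; have [->|xN0] := eqVneq x 0.
  by rewrite psum_coef0 nrm0 mulr0.
pose X := nrm x; have X0 : 0 < X by rewrite nrm_gt0.
have Xpow0 j : 0 < X * 2^-1 ^+ j.+1 by rewrite mulr_gt0 // exprn_gt0.
have step (q : nat * H) : exists z, nrm (q.2 - z) < X * 2^-1 ^+ q.1.+1 /\
    forall n, nrm (S z n) <= K * nrm q.2.
  by have [z ? ?] := approx q.2 _ (Xpow0 q.1); exists z.
have [f fP] := choice step.
pose fix y j := if j is i.+1 then y i - f (i, y i) else x.
pose w j := x - y j.
have yX j : nrm (y j) <= X * 2^-1 ^+ j.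
  case: j => [|j] /=; first by rewrite expr0 mulr1.
  by apply: ltW; case: (fP (j, y j)).
have wS n j : nrm (S (w j.+1) n - S (w j) n) <= K * X * 2^-1 ^+ j.
  rewrite -psum_coefB (_ : w j.+1 - w j = f (j, y j)).
    have [_ /(_ n) /le_trans] := fP (j, y j); apply.
    by rewrite -mulrA ler_wpM2l ?yX.
  by rewrite /w /= !opprB [x + _]addrC addrACA subrK subrr addr0.
have /choice[T TP] n : exists v, (fun j => S (w j) n) @ \oo --> v /\
    forall j, nrm (v - S (w j) n) <= 2 * (K * X) * 2^-1 ^+ j.
  by have [v ? ?] := nrm_geometric_cvg (wS n); exists v.
(* T n.+1 - T n is a limit of multiples of b n *)
have /choice[d dP] n : exists l, T n.+1 - T n = l *: b n.
  apply: (line_closed (a := fun j => coef (w j) n)).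
  rewrite (_ : (fun j => _) = fun j => S (w j) n.+1 - S (w j) n); last first.
    by apply/funext => j; rewrite psumS addrC addKr.
  exact: cvgB (TP n.+1).1 (TP n).1.
have T_psum n : T n = psum b d n.
  elim: n => [|n IHn]; last by rewrite psumS -IHn -dP addrC subrK.
  apply: (cvg_unique (@norm_hausdorff _ H) (TP 0%N).1).
  rewrite (_ : (fun j => _) = fun=> psum b d 0); first exact: cvg_cst.
  by apply/funext => j; rewrite /psum !big_geq.
have T_cvg : psum b d @ \oo --> x.
  apply/nrm_cvgP => e e0.
  have e2 : 0 < e / 2 by rewrite divr_gt0.
  have [j je] := small_half_pow (2 * (K * X) + X) e2.
  have [N NS] := (nrm_cvgP _ _).1 (coefP (w j)) _ e2.
  exists N => n /NS wn; rewrite -T_psum.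
  have := nrm_triangle (w j) x (T n).
  have := nrm_triangle (S (w j) n) (w j) (T n).
  have := (TP n).2 j; have := yX j.
  have -> : x - w j = y j by rewrite /w opprB addrC subrK.
  by rewrite (nrmBC (S _ _)); move: je; rewrite mulrDl; lra.
have <- : T n0 = S x n0.
  by rewrite T_psum; apply: eq_bigr => k _; rewrite (coef_unique T_cvg).
have := (TP n0).2 0%N.
by rewrite /w /= subrr psum_coef0 subr0 expr0 mulr1 mulrA.
Qed.

Lemma coef_basis k j : coef (b k) j = (j == k)%:R.
Proof.
apply/esym; apply: (coef_unique (d := fun j => (j == k)%:R)).
apply/nrm_cvgP => e e0.
exists k.+1 => n kn; rewrite /psum (bigD1_seq k) ?mem_index_iota ?iota_uniq //=.
rewrite eqxx scale1r big1 ?addr0 ?subrr ?nrm0 // => i /negbTE ->.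
by rewrite scale0r.
Qed.

(** The [k]-th coordinate is continuous, takes the value 1 at [b k] and vanishes
    on the span of the other basis vectors. *)
Lemma basis_minimal k :
  ~ closed_span [set b j | j in [set j | j != k]] (b k).
Proof.
have [K KP] := psum_bounded.
have bk0 : 0 < nrm (b k) by rewrite nrm_gt0 basis_neq0.
have coef_le x : nrm (coef x k *: b k) <= 2 * K * nrm x.
  have -> : coef x k *: b k = S x k.+1 - S x k by rewrite psumS addrC addKr.
  by have := nrmB (S x k.+1) (S x k); have := KP x k.+1; have := KP x k; lra.
have K0 : 0 < 2 * K.
  have := coef_le (b k); rewrite coef_basis eqxx scale1r.
  by move=> /(lt_le_trans bk0); rewrite pmulr_lgt0.
move=> /nrm_closureP /(_ (nrm (b k) / (2 * K)))[|v [n [s [a [sb ->]]]] sv].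
  by rewrite divr_gt0.
have coef0 : coef (\sum_i a i *: s i) k = 0.
  apply: (big_ind (fun x => coef x k = 0)) => [|x y xk yk|i _].
  - by have := coef_lin (-1) 0 0 k; rewrite scaler0 addr0 mulN1r addNr.
  - by rewrite -[x]scale1r coef_lin xk yk mulr0 addr0.
  - have [j /= jk <-] := sb i; rewrite -[_ *: _]addr0 coef_lin.
    rewrite coef_basis eq_sym (negbTE jk) mulr0 add0r.
    by have := coef_lin (-1) 0 0 k; rewrite scaler0 addr0 mulN1r addNr.
have := coef_le (b k - \sum_i a i *: s i).
rewrite addrC -scaleN1r coef_lin coef0 coef_basis eqxx mulr0 add0r !scale1r.
rewrite scaleN1r addrC leNgt => /negP; apply.
by rewrite mulrC -ltr_pdivlMr.
Qed.

End SchauderMinimality.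

(** * Closed spans and orthogonal projections *)

Section Spans.
Local Open Scope complex_scope.
Context {R : realType} {H : completeNormedModType R[i]}.
Implicit Types (x y : H) (S T V : set H).

Lemma lin_span_sub S : S `<=` lin_span S.
Proof.
move=> x Sx; exists 1%N, (fun=> x), (fun=> 1); split=> //.
by rewrite big_ord1 scale1r.
Qed.

Lemma lin_span0 S : lin_span S 0.
Proof.
by exists 0%N, (fun=> 0), (fun=> 0); rewrite big_ord0; split=> // -[].
Qed.

Lemma lin_span_lin S a x y :
  lin_span S x -> lin_span S y -> lin_span S (a *: x + y).
Proof.
move=> [m [v [c [Sv ->]]]] [n [w [d [Sw ->]]]].
exists (m + n)%N.
exists (fun k =>
  match fintype.split k with inl i => v i | inr j => w j end).
exists (fun k =>
  match fintype.split k with inl i => a * c i | inr j => d j end); split.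
  by move=> k; case: fintype.split => [i|j].
rewrite big_split_ord scaler_sumr /=; congr (_ + _); apply: eq_bigr => i _.
  by rewrite (unsplitK (inl i)) scalerA.
by rewrite (unsplitK (inr i)).
Qed.

Lemma closed_spanS S T : S `<=` T -> closed_span S `<=` closed_span T.
Proof.
move=> ST; apply: closure_subset => x [n [v [c [Sv ->]]]].
by exists n, v, c; split=> // i; exact/ST/Sv.
Qed.

Lemma closed_span_sub S : S `<=` closed_span S.
Proof. by move=> x Sx; exact/subset_closure/lin_span_sub. Qed.

Lemma closed_span_subspace S : closed_subspace (closed_span S).
Proof.
split; first exact: closed_closure.
split=> [|a x y /set_mem Sx /set_mem Sy]; apply/mem_set.
  exact/subset_closure/lin_span0.
apply/nrm_closureP => e e0; pose k := complex.Re `|a| + 1.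
have k0 : 0 < k by rewrite /k ltr_pwDr // (le_trans _ (re_le_norm a)).
have e1 : 0 < e / 2 / k by rewrite !divr_gt0.
have e2 : 0 < e / 2 by rewrite divr_gt0.
have [x' Sx' xx'] := (nrm_closureP _ _).1 Sx _ e1.
have [y' Sy' yy'] := (nrm_closureP _ _).1 Sy _ e2.
exists (a *: x' + y'); first exact: lin_span_lin.
rewrite opprD addrACA -scalerBr; apply: le_lt_trans (nrmD _ _) _.
have : nrm (a *: (x - x')) <= e / 2; last by lra.
rewrite nrmZ; move: xx'; rewrite ltr_pdivlMr // => xx'.
by have := nrm_ge0 (x - x'); move: xx'; rewrite /k; nra.
Qed.

Lemma closed_span_invariant (A : {linear H -> H}) S :
  continuous A -> Defs.invariant A S -> Defs.invariant A (closed_span S).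
Proof.
move=> cA AS _ [x Sx <-] B /cA/Sx [_ [[n [v [c [Sv ->]]]] Bv]].
exists (A (\sum_i c i *: v i)); split=> //.
exists n, (A \o v), c; split=> [i|]; first by apply: AS; exists (v i).
by rewrite linear_sum; apply: eq_bigr => i _; rewrite linearZ.
Qed.

End Spans.

Section Projection.
Local Open Scope complex_scope.
Context {R : realType} {H : completeNormedModType R[i]}.
Variable dot : {dot H for Num.conj}.
Hypothesis dotE : induces_norm dot.
Implicit Types (x y u v p : H) (V : set H).

Lemma dot_nrm x : dot x x = (nrm x ^+ 2)%:C.
Proof. by rewrite -dotE nrmE rmorphXn. Qed.

Lemma dot_eq0 x : dot x x = 0 -> x = 0.
Proof. by move=> xx; apply/eqP; rewrite -(dnorm_eq0 dot) xx. Qed.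

Lemma dot_eq0C x y : dot x y = 0 -> dot y x = 0.
Proof. by move=> xy; rewrite (hermC dot) /= xy rmorph0 mulr0. Qed.

Lemma parallelogram x y :
  nrm (x + y) ^+ 2 + nrm (x - y) ^+ 2 = 2 * nrm x ^+ 2 + 2 * nrm y ^+ 2.
Proof.
apply: complexI; rewrite !rmorphD /= !mulr_natl !rmorphMn /= -!dot_nrm.
rewrite dnormD dnormB /=.
by ring.
Qed.

Lemma pythagoras x y : dot x y = 0 ->
  nrm (x + y) ^+ 2 = nrm x ^+ 2 + nrm y ^+ 2.
Proof.
move=> xy; apply: complexI.
by rewrite rmorphD /= -!dot_nrm dnormD /= xy rmorph0 !addr0.
Qed.

(** If no multiple of [v] is closer to [u] than 0, then [u] is orthogonal to
    [v]: removing from [u] its component along [v] would shorten it. *)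
Lemma nearest_orthogonal u v :
  (forall c : R[i], nrm u <= nrm (u - c *: v)) -> dot v u = 0.
Proof.
move=> umin; have [->|vN0] := eqVneq v 0; first by rewrite linear0l.
pose c := dot u v / dot v v; pose w := u - c *: v.
have wv : dot w v = 0.
  by rewrite linearBl linearZl_LR /= divfK ?subrr // dnorm_eq0.
have : nrm (c *: v) ^+ 2 <= 0.
  have wcv : dot w (c *: v) = 0 by rewrite linearZr_LR /= wv mulr0.
  have := pythagoras wcv; rewrite subrK => uE.
  by have := umin c; rewrite -/w; have := nrm_ge0 u; have := nrm_ge0 w; nra.
rewrite le_eqVlt ltNge sqr_ge0 orbF sqrf_eq0 => /eqP /nrm0_eq0 cv0.
by move: wv; rewrite /w cv0 subr0 => /dot_eq0C.
Qed.

(** A sequence of [V] that minimizes the distance to [x] is Cauchy by the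
    parallelogram identity, and its limit is the projection. *)
Lemma projection_exists V x : closed_subspace V ->
  exists2 p, V p & orthogonal_complement dot V (x - p).
Proof.
move=> [clV [/set_mem V0 /= linV]].
have Vlin a u v : V u -> V v -> V (a *: u + v).
  by move=> /mem_set Vu /mem_set Vv; apply/set_mem; exact: linV.
pose E := [set nrm (x - v) ^+ 2 | v in V].
have lbE : has_lbound E by exists 0 => _ [v _ <-]; exact: sqr_ge0.
have infE : has_inf E by split=> //; exists (nrm (x - 0) ^+ 2), 0.
have leE v : V v -> inf E <= nrm (x - v) ^+ 2.
  by move=> Vv; apply: ge_inf => //; exists v.
have infE0 : 0 <= inf E.
  by apply: lb_le_inf => [|_ [v _ <-]]; [case: infE | exact: sqr_ge0].
pose h n : R := 2^-1 ^+ n.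
have h0 n : 0 < h n by rewrite exprn_gt0.
have /choice[v vP] n : exists v, V v /\ nrm (x - v) ^+ 2 < inf E + h n ^+ 2.
  have h20 : 0 < h n ^+ 2 by rewrite exprn_gt0.
  by have [_ [v Vv <-] ve] := inf_adherent h20 infE; exists v.
(* parallelogram identity: the midpoint of v n and v n.+1 is in V *)
have vC n : nrm (v n.+1 - v n) <= 2 * h n.
  have := parallelogram (x - v n.+1) (x - v n).
  have -> : x - v n.+1 - (x - v n) = v n - v n.+1.
    by rewrite opprB addrC subrKA.
  have -> : x - v n.+1 + (x - v n) =
      (2%:R)%:C *: (x - (2%:R^-1)%:C *: (v n.+1 + v n)).
    rewrite scalerBr scalerA -rmorphM /= divff ?pnatr_eq0 // scale1r.
    by rewrite rmorph_nat scaler_nat mulr2n opprD addrACA.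
  rewrite nrmZR // exprMn.
  have /leE : V ((2%:R^-1)%:C *: (v n.+1 + v n)).
    rewrite scalerDr; apply: (Vlin _ _ _ (vP _).1).
    by rewrite -[_ *: _]addr0; apply: (Vlin _ _ _ (vP _).1).
  have := (vP n).2; have := (vP n.+1).2.
  rewrite (_ : h n.+1 = 2^-1 * h n) ?[h _]exprS // (nrmBC (v n.+1)) => ? ? ? ?.
  rewrite -(ler_pXn2r (ltn0Sn 1)) ?nnegrE ?nrm_ge0 ?mulr_ge0 ?(ltW (h0 n)) //.
  by nra.
have [p vp _] := nrm_geometric_cvg vC.
have Vp : V p.
  apply: (closed_cvg (F := \oo) (u_ := v) V clV _ p vp).
  by apply: nearW => n; case: (vP n).
have pmin u : V u -> nrm (x - p) <= nrm (x - u).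
  move=> /leE Vu; have rt0 := sqrtr_ge0 (inf E); have rtE := sqr_sqrtr infE0.
  suff : nrm (x - p) <= Num.sqrt (inf E) by have := nrm_ge0 (x - u); nra.
  apply/ler_addgt0Pr => e e0; apply: (cvg_nrm_le vp).
  have [M Me] := small_half_pow 1 e0; exists M => n Mn.
  have hn : h n < e.
    apply: le_lt_trans Me.
    by rewrite mul1r ler_wiXn2l // ?invr_ge0 // invf_le1 ?ler1n.
  have [_ vn] := vP n; have := h0 n; have := nrm_ge0 (x - v n).
  by nra.
exists p => // u Vu; apply: nearest_orthogonal => c.
by rewrite -addrA -opprD (addrC p); apply: pmin; exact: Vlin.
Qed.

End Projection.

(** * Orbits of a reductive normal operator *)

Section ReductiveNormal.
Context {R : realType} {H : completeNormedModType R[i]}.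
Variable dot : {dot H for Num.conj}.
Hypothesis dotE : induces_norm dot.
Variable A : {linear H -> H}.

(** With [B] the adjoint, [B u] and [A u] have the same norm, and
    [dot (A x) u = dot x (B u)]. *)
Lemma normal_ker_orthogonal_range u :
  normal_op dot A -> A u = 0 -> forall x, dot (A x) u = 0.
Proof.
move=> [B adjAB AB] Au0 x; rewrite adjAB.
suff -> : B u = 0 by rewrite linear0r.
apply: (dot_eq0 (dot := dot)); rewrite -adjAB; have /= -> := AB u; rewrite Au0.
by apply: dot_eq0C; rewrite -adjAB Au0 linear0l.
Qed.

(** The operator half of the argument: [u = A g - p], with [p] the projection of
    [A g] on the closed span, is in the kernel of [A] and orthogonal to
    itself. *)
Lemma image_in_tail_span (g : H) :
  bounded_op A -> reductive dot A -> normal_op dot A ->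
  closed_span [set iter n A g | n in [set n | (2 <= n)%N]] (A g).
Proof.
move=> /bounded_linear_continuous cA redA normA; set W := closed_span _.
have subW : closed_subspace W := closed_span_subspace _.
have AW : Defs.invariant A W.
  apply: closed_span_invariant => // _ [_ [n /= n2 <-] <-].
  by exists n.+1 => //=; exact: leqW.
have [p Wp /= pW] := projection_exists dotE (A g) subW.
have Au0 : A (A g - p) = 0.
  apply: (dot_eq0 (dot := dot)); apply: (redA _ subW AW).
    by exists (A g - p).
  rewrite linearB; apply/set_mem; have [_ [_ linW]] := subW.
  rewrite addrC -scaleN1r; apply: linW; apply/mem_set.
    by apply: AW; exists p.
  by apply: closed_span_sub; exists 2%N.
suff /eqP : A g - p = 0 by rewrite subr_eq0 => /eqP ->.
apply: (dot_eq0 (dot := dot)); rewrite linearBl /= (pW p) // subr0.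
exact: normal_ker_orthogonal_range.
Qed.

End ReductiveNormal.

(** * Bases of iterates *)

Section Enumeration.
Context {R : realType} {H : completeNormedModType R[i]}.

Lemma expansion_setT (I : Type) (f : I -> H) (e : nat -> I) c x :
  expansion f setT e c x = (psum (f \o e) c @ \oo --> x).
Proof.
rewrite /expansion (_ : (fun n => _) = psum (f \o e) c) //.
by apply/funext => n; apply: eq_bigl => k; rewrite in_setT.
Qed.

(** A basis enumerated by finitely many integers would span [H], so the
    enumeration is by all of [nat]. *)
Lemma schauder_basis_enumeration (I : Type) (f : I -> H) (J : set I) :
  infinite_dimensional H -> schauder_basis f J ->
  exists2 e : nat -> I, set_bij setT J e &
    forall x, exists2 c, expansion f setT e c x &
      forall c', expansion f setT e c' x -> c' =1 c.
Proof.
move=> infH [D [e [[downD bijD] basisD]]].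
suff DT : D = setT.
  rewrite DT in bijD basisD; exists e => // x.
  have [c cx cu] := basisD x; exists c => // c' /cu c'c k.
  by apply: c'c; rewrite in_setT.
apply: contrapT => DnT; have [N DN] : exists N, ~ D N.
  apply: contrapT => nex; apply: DnT; apply/seteqP; split=> // n _.
  by apply: contrapT => Dn; apply: nex; exists n.
have ltDN k : D k -> (k < N)%N.
  by move=> Dk; rewrite ltnNge; apply/negP => Nk; apply: DN; exact: downD Dk.
apply: (infH [set f (e k) | k in D]).
  by apply: finite_image; exact: sub_finite_set ltDN (finite_II N).
apply/seteqP; split=> // x _; have [c /nrm_cvgP cx _] := basisD x.
(* the partial sums of the expansion of x are constant from rank N on *)
have -> : x = \sum_(0 <= k < N | k \in D) c k *: f (e k).
  apply/eqP; rewrite -subr_eq0; apply/eqP/nrm0_eq0/eqP.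
  rewrite eq_le nrm_ge0 andbT; apply/ler_addgt0Pr => eps /cx[M /(_ (maxn M N))].
  rewrite leq_maxl add0r => /(_ isT) /ltW.
  rewrite (big_cat_nat _ (n := N)) ?leq_maxr //=.
  rewrite [X in _ - (_ + X)]big1_seq ?addr0 //.
  move=> k /andP[/set_mem /ltDN kN]; rewrite mem_index_iota => /andP[Nk _].
  by rewrite ltnNge Nk in kN.
apply: (big_ind (lin_span [set f (e k) | k in D])).
- exact: lin_span0.
- by move=> y z Sy Sz; rewrite -[y]scale1r; exact: lin_span_lin.
- move=> k /set_mem Dk; rewrite -[_ *: _]addr0; apply: lin_span_lin.
    by apply: lin_span_sub; exists k.
  exact: lin_span0.
Qed.

Lemma schauder_basis_minimal (I : Type) (f : I -> H) (J : set I) (i : I) :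
  infinite_dimensional H -> schauder_basis f J -> J i ->
  ~ closed_span [set f j | j in [set j | J j /\ j <> i]] (f i).
Proof.
move=> infH /(schauder_basis_enumeration infH)[e [eJ einj esurj] basis].
have /choice[coef coefP] (x : H) : exists c : nat -> R[i],
    psum (f \o e) c @ \oo --> x /\
    forall c', psum (f \o e) c' @ \oo --> x -> c' =1 c.
  have [c cx cu] := basis x; exists c; split=> [|c' c'x].
    by rewrite -expansion_setT.
  by apply: cu; rewrite expansion_setT.
move=> /esurj[k _ <-] /= fk.
apply: (basis_minimal (b := f \o e) (coef := coef) _ _ (k := k)).
- by move=> x; case: (coefP x).
- by move=> x; case: (coefP x).
apply: closed_spanS fk => _ [_ [/esurj[j _ <-] jk] <-]; exists j => //=.
by apply/eqP => jkE; rewrite jkE in jk.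
Qed.

Lemma schauder_basis_infinite_index (I : Type) (f : I -> H) (J : set I) :
  infinite_dimensional H -> schauder_basis f J -> infinite_set J.
Proof.
move=> infH /(schauder_basis_enumeration infH)[e [eJ einj _] _] finJ.
apply: infinite_nat; apply: (@sub_finite_set _ _ (e @^-1` J)) => [n _|].
  exact: eJ.
by apply: finite_preimage finJ => m n _ _; exact: einj (in_setT m) (in_setT n).
Qed.

Lemma finite_iter_index (G : set H) (L : G -> Nstar) : finite_set G ->
  (forall g, L g <> None) -> finite_set (iter_index L).
Proof.
move=> finG LN.
apply: (@sub_finite_set _ _
  (\bigcup_(h in G) [set gn | gn.1 = h /\ iter_index L gn])).
  move=> gn Jgn; exists gn.1 => //.
  by case: Jgn => g [-> _]; exact: set_valP.
apply: bigcup_finite => // h Gh; pose g : G := exist _ h (mem_set Gh).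
case Lg: (L g) => [m|]; last by have := LN g.
apply: (@sub_finite_set _ _ ([set h] `*` `I_(val m))).
  move=> [h' n] /= [-> [g' [/= hg' ltn]]]; split=> //=.
  have gg' : g' = g by apply: val_inj; rewrite /= -hg'.
  by move: ltn; rewrite gg' Lg.
exact: finite_setX (finite_set1 h) (finite_II _).
Qed.

End Enumeration.

Theorem corollary4p5 (R : realType) (H : completeNormedModType R[i])
    (dot : {dot H for Num.conj}) (dotE : induces_norm dot)
    (sepH : separable H) (infH : infinite_dimensional H)
    (A : {linear H -> H}) (bddA : bounded_op A)
    (redA : reductive dot A) (normA : normal_op dot A)
    (G : set H) (finG : finite_set G)
    (L : G -> Nstar) (LA : class_L A L) :
  ~ schauder_basis (iterates A) (iter_index L).
Proof.
move=> basis.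
have [g Lg] : exists g, L g = None.
  apply: contrapT => nex; apply: (schauder_basis_infinite_index infH basis).
  by apply: finite_iter_index finG _ => g Lg; apply: nex; exists g.
have Jg n : iter_index L (val g, n) by exists g; rewrite Lg.
(* the index (g, 1) carries the vector A g *)
apply: (schauder_basis_minimal infH basis (Jg 1%N)).
have Ag := image_in_tail_span dotE (g := val g) bddA redA normA.
apply: (closed_spanS _ Ag).
move=> _ [n /= n2 <-]; exists (val g, n) => //; split; first exact: Jg.
by case=> n1; rewrite n1 in n2.
Qed.
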